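(* There are absolute constants $\eta>0$ and $C<\infty$ such that for every positive integer $k$ there are signs $\{\varepsilon_{i,j}\}_{i,j=1}^k\in\{-1,1\}^{k^2}$ for which, letting $B=(\varepsilon_{i,j})_{i,j=1}^k$, $A=[\sqrt{k}\,I_k,\,B]$ and $\bar A=[-B^*,\,\sqrt{k}\,I_k]$ (both $k\times 2k$ matrices), one has for all $a\in S^{k-1}$ \[ C^{-1}\le \|aA\|_{L_1^{2k}}\le \|aA\|_{L_2^{2k}}\le C \] and \[ C^{-1}\le \|a\bar A\|_{L_1^{2k}}\le \|a\bar A\|_{L_2^{2k}}\le C . \] Moreover, if the signs $\{\varepsilon_{i,j}\}_{i,j=1}^k$ are chosen uniformly at random from $\{-1,1\}^{k^2}$, then the probability that these inequalities hold for all $a\in S^{k-1}$ is larger than $1-e^{-\eta k}$.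
   Context: For $0<p<\infty$ and $n\in\mathbb{N}$, $\|x\|_{L_p^n}=\big(n^{-1}\sum_{i=1}^n|x_i|^p\big)^{1/p}$ for $x=(x_1,\dots,x_n)\in\mathbb{R}^n$. $S^{k-1}$ is the Euclidean unit sphere of $\mathbb{R}^k$ (unit vectors for the unnormalized norm $(\sum_i a_i^2)^{1/2}$). $B^*$ is the transpose of $B$, and $I_k$ is the $k\times k$ identity matrix. $[M,N]$ denotes the $k\times 2k$ matrix whose first $k$ columns form $M$ and whose last $k$ columns form $N$. The vector $a\in\mathbb{R}^k$ is treated as a row vector, so $aA,a\bar A\in\mathbb{R}^{2k}$. *)

(* Defs.v *)
From HB Require Import structures.
From mathcomp Require Import all_boot all_order all_algebra.
From mathcomp Require Import all_classical all_reals all_analysis.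

Set Implicit Arguments.
Unset Strict Implicit.
Unset Printing Implicit Defensive.

Import Order.TTheory GRing.Theory Num.Theory.

Local Open Scope ring_scope.

Definition Lpn_norm (R : realType) (n : nat) (p : R) (x : 'rV[R]_n) : R :=
  (n%:R^-1 * \sum_(i < n) `|x ord0 i| `^ p) `^ p^-1.

Definition unit_sphere (R : realType) (k : nat) : set 'rV[R]_k :=
  [set a | Num.sqrt (\sum_(i < k) a ord0 i ^+ 2) = 1].

(* A choice of signs is encoded by a boolean matrix: [false] stands for [1] and
   [true] for [-1]. *)
Definition sign_mx (R : realType) (k : nat) (e : 'M[bool]_k) : 'M[R]_k :=
  \matrix_(i, j) (-1) ^+ e i j.

Definition mxA (R : realType) (k : nat) (B : 'M[R]_k) : 'M[R]_(k, k + k) :=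
  row_mx (Num.sqrt k%:R *: 1%:M) B.

Definition mxAbar (R : realType) (k : nat) (B : 'M[R]_k) : 'M[R]_(k, k + k) :=
  row_mx (- B^T) (Num.sqrt k%:R *: 1%:M).

Definition norms_within (R : realType) (n : nat) (C : R) (x : 'rV[R]_n) : Prop :=
  [/\ C^-1 <= Lpn_norm 1 x, Lpn_norm 1 x <= Lpn_norm 2 x & Lpn_norm 2 x <= C].

Definition good_signs (R : realType) (k : nat) (C : R) (e : 'M[bool]_k) : Prop :=
  forall a : 'rV[R]_k, unit_sphere a ->
    norms_within C (a *m mxA (sign_mx R e)) /\
    norms_within C (a *m mxAbar (sign_mx R e)).

Definition uniform_pr (R : realType) (T : finType) (E : T -> Prop) : R :=
  #|[set x : T | `[< E x >]]|%:R / #|T|%:R.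

(* Main.v *)
Require Import Defs.
From HB Require Import structures.
From mathcomp Require Import all_boot all_order all_algebra.
From mathcomp Require Import all_classical all_reals all_analysis.
From mathcomp Require Import ring lra.

(* With high probability [B] has operator norm at most [30 sqrt k]: this is
   Hoeffding's bound for the bilinear form [x B y^T] and a union bound over a
   grid.  It gives the upper L_2 bounds.  For the lower L_1 bound, the block
   [sqrt k I] is enough unless the l1-norm of [a] is at most [d sqrt k].  In
   that case, rounding [a] towards zero to a multiple of [h / sqrt k] gives an
   integer vector of l1-norm at most [(d / h) k], and there are only
   [exp (o(1) k)] of these as [d] tends to 0.  For each fixed one, [|v B|_1] is
   at least [c k] up to probability [exp (- c' k)] by Chernoff's bound, hence
   this holds for all of them at once, and the bound on the operator norm
   transfers it to [a].  The finitely many small [k], for which these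
   probability bounds are void, are handled by trivial bounds on the norms. *)

Set Implicit Arguments.
Unset Strict Implicit.

Import Order.TTheory GRing.Theory Num.Theory.

Local Open Scope ring_scope.

(** * Averages and probabilities over a finite type *)

Definition mean {R : realType} {T : finType} (F : T -> R) : R :=
  (\sum_x F x) / #|T|%:R.

Lemma eq_mean {R : realType} {T : finType} (F G : T -> R) :
  F =1 G -> mean F = mean G.
Proof. by move=> FG; rewrite /mean (eq_bigr G). Qed.

Lemma meanD {R : realType} {T : finType} (F G : T -> R) :
  mean (fun x => F x + G x) = mean F + mean G.
Proof. by rewrite /mean big_split mulrDl. Qed.

Lemma meanZ {R : realType} {T : finType} (c : R) (F : T -> R) :
  mean (fun x => c * F x) = c * mean F.
Proof. by rewrite /mean -mulr_sumr mulrA. Qed.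

Lemma mean_sum {R : realType} {T I : finType} (F : I -> T -> R) :
  mean (fun x => \sum_i F i x) = \sum_i mean (F i).
Proof. by rewrite /mean exchange_big /= mulr_suml. Qed.

Lemma mean_cst {R : realType} {T : finType} (c : R) :
  (0 < #|T|)%N -> mean (fun _ : T => c) = c.
Proof.
move=> T0; rewrite /mean sumr_const -[c *+ _]mulr_natr mulfK //.
by rewrite pnatr_eq0 -lt0n.
Qed.

Lemma ler_mean {R : realType} {T : finType} (F G : T -> R) :
  (forall x, F x <= G x) -> mean F <= mean G.
Proof. by move=> FG; rewrite /mean ler_wpM2r ?invr_ge0// ler_sum. Qed.

Lemma mean_bool {R : realType} (F : bool -> R) :
  mean F = (F true + F false) / 2.
Proof. by rewrite /mean big_bool card_bool. Qed.

Lemma mean_reindex {R : realType} {T : finType} (h : T -> T) (F : T -> R) :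
  involutive h -> mean (fun x => F (h x)) = mean F.
Proof.
move=> hK; rewrite /mean [in RHS](reindex h) //=.
exact/onW_bij/inv_bij.
Qed.

(** Independence of the coordinates of a uniform function: distributing the product of sums gives a
    sum over all functions. *)
Lemma mean_prod_ffun {R : realType} {I J : finType} (F : I -> J -> R) :
  mean (fun f : {ffun I -> J} => \prod_i F i (f i)) = \prod_i mean (F i).
Proof.
rewrite /mean prodf_div bigA_distr_bigA /= card_ffun prodr_const natrX.
by rewrite cardT.
Qed.

Definition col_ffun {T : finType} {k : nat} (e : 'M[T]_k) (j : 'I_k) :
  {ffun 'I_k -> T} := [ffun i => e i j].

(** Independence of the columns: a matrix is a function from column indices to columns, so
    [mean_prod_ffun] applies. *)
Lemma mean_prod_col {R : realType} {T : finType} {k : nat}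
    (G : 'I_k -> {ffun 'I_k -> T} -> R) :
  mean (fun e : 'M[T]_k => \prod_j G j (col_ffun e j)) = \prod_j mean (G j).
Proof.
rewrite -mean_prod_ffun /mean card_mx !card_ffun card_ord expnM; congr (_ / _).
pose g (f : {ffun 'I_k -> {ffun 'I_k -> T}}) : 'M[T]_k := \matrix_(i, j) f j i.
rewrite (reindex g) /=; last first.
  exists (fun e => [ffun j => col_ffun e j]) => [f|e] _.
    by apply/ffunP => j; apply/ffunP => i; rewrite !ffunE mxE.
  by apply/matrixP => i j; rewrite mxE !ffunE.
apply: eq_bigr => f _; apply: eq_bigr => j _; congr (G j _).
by apply/ffunP => i; rewrite ffunE mxE.
Qed.

Lemma uniform_prE {R : realType} {T : finType} (E : T -> Prop) :
  uniform_pr R E = mean (fun x => `[< E x >]%:R).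
Proof.
rewrite /uniform_pr /mean -sum1_card natr_sum; congr (_ / _).
rewrite big_mkcond /=; apply: eq_bigr => x _.
by rewrite inE; case: ifP.
Qed.

(** Markov's inequality. It gives Chernoff bounds when [F] is an exponential and union bounds when
    [F] is a sum of indicators. *)
Lemma uniform_pr_le_mean {R : realType} {T : finType} (E : T -> Prop)
    (F : T -> R) :
  (forall x, 0 <= F x) -> (forall x, E x -> 1 <= F x) ->
  uniform_pr R E <= mean F.
Proof.
move=> F0 F1; rewrite uniform_prE; apply: ler_mean => x.
by case: asboolP => [/F1|].
Qed.

Lemma uniform_prC {R : realType} {T : finType} (E : T -> Prop) :
  (0 < #|T|)%N -> uniform_pr R (fun x => ~ E x) = 1 - uniform_pr R E.
Proof.
move=> T0; apply/esym/eqP; rewrite subr_eq !uniform_prE -meanD.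
rewrite -[X in X == _](mean_cst (T := T)) //; apply/eqP/eq_mean => x.
by rewrite asbool_neg; case: asbool; rewrite ?addr0 ?add0r.
Qed.

Lemma uniform_pr_bigU {R : realType} {T I : finType} (P : pred I)
    (E : I -> T -> Prop) (b : R) :
  (forall i, P i -> uniform_pr R (E i) <= b) ->
  uniform_pr R (fun x => exists2 i, P i & E i x) <= #|P|%:R * b.
Proof.
move=> Eb; apply: (@le_trans _ _ (\sum_(i | P i) uniform_pr R (E i))).
  rewrite (eq_bigr (fun i => mean (fun x => `[< E i x >]%:R))); last first.
    by move=> i _; rewrite uniform_prE.
  rewrite /mean -mulr_suml exchange_big /=.
  apply: uniform_pr_le_mean => [x|x [i Pi Ei]]; first exact: sumr_ge0.
  by rewrite (bigD1 i) //= (asboolT Ei) lerDl sumr_ge0.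
apply: (le_trans (ler_sum _ Eb)).
by rewrite sumr_const mulr_natl.
Qed.

Lemma uniform_prU {R : realType} {T : finType} (E F : T -> Prop) :
  uniform_pr R (fun x => E x \/ F x) <= uniform_pr R E + uniform_pr R F.
Proof.
rewrite (uniform_prE E) (uniform_prE F) -meanD.
apply: uniform_pr_le_mean => [x|x [|] /asboolT ->]; first exact: addr_ge0.
  by rewrite lerDl.
by rewrite lerDr.
Qed.

Lemma le_uniform_pr {R : realType} {T : finType} (E F : T -> Prop) :
  (forall x, E x -> F x) -> uniform_pr R E <= uniform_pr R F.
Proof.
move=> EF; rewrite (uniform_prE F).
by apply: uniform_pr_le_mean => // x /EF /asboolT ->.
Qed.

(** * Rademacher sums: exponential and absolute moments *)

Definition rad_sum {R : realType} {I : finType} (w : I -> R)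
  (f : {ffun I -> bool}) : R := \sum_i (-1) ^+ f i * w i.

(** The non-optimal factor [2] allows an elementary proof. For [0 <= x <= 1/2], bounding the
    exponentials by [1 / (1 - x)] and [1 / (1 + x)] suffices; beyond [1/2], both exponents are at
    most [2 * x ^+ 2]. *)
Lemma cosh_le {R : realType} (x : R) :
  (expR x + expR (- x)) / 2 <= expR (2 * x ^+ 2).
Proof.
wlog x0 : x / 0 <= x.
  move=> H; have [/H//|/ltW x0] := lerP 0 x.
  by have := H (- x); rewrite opprK sqrrN addrC; apply; rewrite oppr_ge0.
have [x1|x1] := lerP x 2^-1.
  have x2 : x ^+ 2 <= 4^-1.
    have -> : 4^-1 = 2^-1 ^+ 2 :> R by field.
    by apply: lerXn2r; rewrite ?nnegrE//; lra.
  have e1 : expR x <= (1 - x)^-1.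
    rewrite -[x in expR x]opprK expRN lef_pV2 ?posrE ?expR_gt0//; last lra.
    exact: expR_ge1Dx.
  have e2 : expR (- x) <= (1 + x)^-1.
    rewrite expRN lef_pV2 ?posrE ?expR_gt0//; last lra.
    exact: expR_ge1Dx.
  apply: (le_trans _ (expR_ge1Dx _)).
  have : (1 - x)^-1 + (1 + x)^-1 <= 2 * (1 + 2 * x ^+ 2).
    have -> : (1 - x)^-1 + (1 + x)^-1 = 2 / (1 - x ^+ 2).
      have h1 : 1 - x != 0 by rewrite gt_eqF//; lra.
      have h2 : 1 + x != 0 by rewrite gt_eqF//; lra.
      have h3 : 1 - x ^+ 2 != 0 by rewrite gt_eqF//; lra.
      by field; rewrite h1 h2 h3.
    rewrite ler_pdivrMr; last lra.
    by have := sqr_ge0 x; move: (x ^+ 2) x2 => s; nra.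
  lra.
have h1 : expR (- x) <= expR (2 * x ^+ 2) by rewrite ler_expR; nra.
have h2 : expR x <= expR (2 * x ^+ 2) by rewrite ler_expR; nra.
lra.
Qed.

Lemma mean_rad_exp {R : realType} {I : finType} (w : I -> R) :
  mean (fun f => expR (rad_sum w f)) <= expR (2 * \sum_i w i ^+ 2).
Proof.
rewrite /rad_sum (@eq_mean _ _ _ (fun f : {ffun I -> bool} =>
  \prod_i expR ((-1) ^+ f i * w i))); last by move=> f; rewrite expR_sum.
rewrite (mean_prod_ffun (fun i b => expR ((-1) ^+ nat_of_bool b * w i))).
rewrite mulr_sumr expR_sum; apply: ler_prod => i _.
rewrite mean_bool /= expr1 expr0 mulN1r mul1r.
by rewrite divr_ge0 ?addr_ge0 ?expR_ge0//= addrC cosh_le.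
Qed.

Lemma mean_rad_mul {R : realType} {I : finType} (i j : I) :
  mean (fun f : {ffun I -> bool} => (-1) ^+ f i * (-1) ^+ f j : R) =
  (i == j)%:R.
Proof.
(* This product form covers both cases: if [i = j] all factors have mean [1], otherwise the factor
   at [i] has mean [0]. *)
pose F l (b : bool) : R := (if l == i then (-1) ^+ b else 1) *
                           (if l == j then (-1) ^+ b else 1).
rewrite (@eq_mean _ _ _ (fun f : {ffun I -> bool} => \prod_l F l (f l)));
  last first.
  move=> f; have fE m : \prod_l (if l == m then (-1) ^+ f l else 1) =
      (-1) ^+ f m :> R by rewrite -big_mkcond big_pred1_eq.
  by rewrite /F big_split /= !fE.
rewrite mean_prod_ffun; have [ij|ij] := eqVneq i j.
  rewrite big1// => l _; rewrite mean_bool /F -ij.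
  by case: eqVneq => _; rewrite ?expr1 ?expr0 ?mulrNN ?mulr1 divff.
rewrite (bigD1 i) //= mean_bool /F eqxx (negPf ij) !mulr1 expr1 expr0.
by rewrite addNr !mul0r.
Qed.

Lemma mean_rad_sqr {R : realType} {I : finType} (w : I -> R) :
  mean (fun f => rad_sum w f ^+ 2) = \sum_i w i ^+ 2.
Proof.
rewrite (@eq_mean _ _ _ (fun f : {ffun I -> bool} =>
  \sum_i \sum_j (w i * w j) * ((-1) ^+ f i * (-1) ^+ f j))); last first.
  move=> f; rewrite /rad_sum expr2 mulr_suml; apply: eq_bigr => i _.
  by rewrite mulr_sumr; apply: eq_bigr => j _; ring.
rewrite mean_sum; apply: eq_bigr => i _; rewrite mean_sum.
rewrite (bigD1 i) //= meanZ mean_rad_mul eqxx mulr1 -expr2.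
rewrite big1 ?addr0// => j ji.
by rewrite meanZ mean_rad_mul eq_sym (negPf ji) mulr0.
Qed.

(** For [y >= 0] this is [1 + y / 4 <= expR (y / 4)] raised to the fourth power, whence
    [256 = 4 ^ 4]; the second exponential handles [y < 0]. *)
Lemma pow4_le_expR {R : realType} (y : R) :
  y ^+ 4 <= 256 * (expR y + expR (- y)).
Proof.
wlog y0 : y / 0 <= y.
  move=> H; have [/H//|/ltW y0] := lerP 0 y.
  have := H (- y); rewrite opprK addrC exprNn (exprM (-1) 2 2) sqrrN !expr1n.
  by rewrite mul1r; apply; rewrite oppr_ge0.
have e1 := expR_ge1Dx (y / 4).
have : (1 + y / 4) ^+ 4 <= expR (y / 4) ^+ 4 by apply: lerXn2r; rewrite ?nnegrE; lra.
rewrite -expRM_natr divfK // => e4.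
have : y ^+ 4 <= 256 * (1 + y / 4) ^+ 4.
  have -> : 256 * (1 + y / 4) ^+ 4 = (4 + y) ^+ 4 by field.
  by apply: lerXn2r; rewrite ?nnegrE; lra.
have := expR_ge0 (- y); lra.
Qed.

Lemma expR1_le4 {R : realType} : expR 1 <= 4 :> R.
Proof.
have -> : expR 1 = expR 2^-1 ^+ 2 :> R.
  by rewrite -expRM_natr; congr expR; field.
have h : 2^-1 <= expR (- 2^-1) :> R.
  by apply: le_trans (expR_ge1Dx _); lra.
have -> : (4 : R) = 2 ^+ 2 by ring.
apply: lerXn2r; rewrite ?nnegrE ?expR_ge0//.
by rewrite -[2^-1 in leLHS]opprK expRN -[leRHS]invrK lef_pV2// posrE ?expR_gt0.
Qed.

(** The two exponential moments are at most [expR 2 <= 16], and [256 * (16 + 16) = 8192]. *)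
Lemma mean_rad_pow4 {R : realType} {I : finType} (w : I -> R) :
  \sum_i w i ^+ 2 <= 1 -> mean (fun f => rad_sum w f ^+ 4) <= 8192.
Proof.
move=> w1.
apply: (le_trans (ler_mean (fun f => pow4_le_expR (rad_sum w f)))).
rewrite meanZ meanD.
have B (v : I -> R) : \sum_i v i ^+ 2 <= 1 ->
    mean (fun f => expR (rad_sum v f)) <= 16.
  move=> v1; apply: (le_trans (mean_rad_exp v)).
  have -> : (16 : R) = 4 ^+ 2 by ring.
  apply: (@le_trans _ _ (expR 1 ^+ 2)); last first.
    by apply: lerXn2r; rewrite ?nnegrE ?expR_ge0 ?expR1_le4//.
  by rewrite -expRM_natr ler_expR; lra.
have := B _ w1; have : mean (fun f => expR (- rad_sum w f)) <= 16.
  rewrite (@eq_mean _ _ _ (fun f => expR (rad_sum (fun i => - w i) f))).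
    by apply: B; under eq_bigr do rewrite sqrrN.
  move=> f; congr expR; rewrite /rad_sum -sumrN.
  by apply: eq_bigr => i _; rewrite mulrN.
lra.
Qed.

(* [2 |y| >= 3 u y^2 - u^3 y^4] with [u = 1 / 128], which is
   [(t - 1)^2 (t + 2) >= 0] at [t = u |y|], reduces the first absolute moment to
   the second and fourth ones. *)
Lemma mean_rad_abs {R : realType} {I : finType} (w : I -> R) :
  4^-1 <= \sum_i w i ^+ 2 <= 1 -> 1024^-1 <= mean (fun f => `|rad_sum w f|).
Proof.
move=> /andP[w4 w1].
have P (y : R) : 3 / 256 * y ^+ 2 + (- (128^-1 ^+ 3 / 2)) * y ^+ 4 <= `|y|.
  rewrite -(real_normK (num_real y)); have -> : y ^+ 4 = `|y| ^+ 4.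
    by rewrite -normrX ger0_norm// (exprM y 2 2) sqr_ge0.
  have := normr_ge0 y; move: `|y| => t t0.
  suff : 0 <= t * ((t / 128 - 1) ^+ 2 * (t / 128 + 2)) by lra.
  by do 2?[apply: mulr_ge0] => //; [exact: sqr_ge0|lra].
apply: le_trans (ler_mean (fun f => P (rad_sum w f))).
(* The second moment contributes at least [3 / 1024] and the fourth one removes at most
   [2 / 1024]. *)
rewrite meanD !meanZ mean_rad_sqr; have := mean_rad_pow4 w1; lra.
Qed.

(** Averaging [expR (- t) <= 1 - t + t ^+ 2] at [t = l * |rad_sum w f|] loses [l] times the first
    absolute moment, at least [2 * l ^+ 2], and gains at most [l ^+ 2]; the result is at most
    [1 - l ^+ 2]. *)
Lemma mean_rad_exp_abs (R : realType) : exists l : R, 0 < l <= 1 /\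
  forall (I : finType) (w : I -> R), 4^-1 <= \sum_i w i ^+ 2 <= 1 ->
    mean (fun f => expR (- (l * `|rad_sum w f|))) <= expR (- l ^+ 2).
Proof.
have [l [/andP[l0 l1] labs]] : exists l : R, 0 < l <= 1 /\
    forall (I : finType) (w : I -> R), 4^-1 <= \sum_i w i ^+ 2 <= 1 ->
    2 * l <= mean (fun f => `|rad_sum w f|).
  exists 2048^-1; split=> [|I w /mean_rad_abs]; [by apply/andP; split; lra|lra].
exists l; split=> [|I w w41]; first by rewrite l0.
have /andP[w4 w1] := w41.
(* Here [expR (- t) <= 1 / (1 + t)], and [(1 + t) * (1 - t + t ^+ 2) = 1 + t ^+ 3 >= 1]. *)
have P (t : R) : 0 <= t -> expR (- t) <= 1 + ((-1) * t + t ^+ 2).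
  move=> t0; apply: (@le_trans _ _ (1 + t)^-1).
    rewrite expRN lef_pV2 ?posrE ?expR_gt0//; last lra.
    exact: expR_ge1Dx.
  by rewrite -[leLHS]mul1r ler_pdivrMr; nra.
apply: (@le_trans _ _ (mean (fun f => 1 + ((- l) * `|rad_sum w f| +
                       l ^+ 2 * rad_sum w f ^+ 2)))).
  apply: ler_mean => f; apply: (le_trans (P _ _)).
    by rewrite mulr_ge0// ltW.
  by rewrite exprMn real_normK ?num_real// mulN1r mulNr.
rewrite !meanD !meanZ mean_rad_sqr mean_cst; last first.
  by rewrite card_ffun expn_gt0 card_bool.
apply: le_trans (expR_ge1Dx _); have := labs _ _ w41; nra.
Qed.

(** * Norms, the bilinear form, and counting and rounding on the integer grid *)

Definition l1norm {R : realType} {k : nat} (a : 'rV[R]_k) : R :=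
  \sum_i `|a ord0 i|.

Definition sqnorm {R : realType} {k : nat} (a : 'rV[R]_k) : R :=
  \sum_i a ord0 i ^+ 2.

Definition bilin {R : realType} {k : nat} (B : 'M[R]_k) (x y : 'rV[R]_k) : R :=
  \sum_j (x *m B) ord0 j * y ord0 j.

(* An integer vector is a difference of two natural ones; the double counting
   only matters up to a factor that tends to [1] with the sparsity. *)
Definition grid (k m : nat) := {ffun 'I_k -> 'I_m.+1 * 'I_m.+1}.

Definition grid_weight {k m : nat} (z : grid k m) : nat :=
  \sum_i ((z i).1 + (z i).2).

Definition sparse {R : realType} {k m : nat} (th : R) : pred (grid k m) :=
  [pred z | (grid_weight z)%:R <= th * k%:R].

Definition grid_vec {R : realType} {k m : nat} (s : R) (z : grid k m) :
  'rV[R]_k := \row_i (s * ((z i).1%:R - (z i).2%:R)).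

Lemma sum_geometric_le {R : realType} (x : R) (n : nat) :
  0 <= x < 1 -> \sum_(i < n) x ^+ i <= (1 - x)^-1.
Proof.
move=> /andP[x0 x1]; have x10 : 0 < 1 - x by lra.
rewrite -[leRHS]mul1r ler_pdivlMr // mulrC.
have := subrX1 x n; have := exprn_ge0 n x0; lra.
Qed.

(** Counting by a generating function: with [x = expR (- u)], each sparse [z] has [expR (th * u * k)
    * x ^+ grid_weight z >= 1]. The sum over all [z] factors into [2 * k] truncated geometric
    series, each at most [1 + 1 / u <= expR (1 / u)] whatever [m] is. *)
Lemma card_sparse {R : realType} {k m : nat} (u th : R) : 0 < u ->
  #|@sparse R k m th|%:R <= expR ((2 / u + th * u) * k%:R).
Proof.
move=> u0; set x := expR (- u).
have x01 : 0 <= x < 1 by rewrite expR_ge0 expR_lt1 oppr_lt0.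
have geo n : \sum_(i < n) x ^+ i <= expR u^-1.
  apply: (le_trans (sum_geometric_le n x01)); apply: (le_trans _ (expR_ge1Dx _)).
  have -> : 1 + u^-1 = (u / (1 + u))^-1 by field; rewrite !gt_eqF//; lra.
  have xu : x <= (1 + u)^-1.
    rewrite /x expRN lef_pV2 ?posrE ?expR_gt0//; last lra.
    exact: expR_ge1Dx.
  have E : u / (1 + u) = 1 - (1 + u)^-1 by field; rewrite gt_eqF//; lra.
  rewrite lef_pV2 ?posrE; [by rewrite E; lra| |by rewrite divr_gt0//; lra].
  by case/andP: x01; lra.
rewrite -sum1_card natr_sum.
apply: (@le_trans _ _ (\sum_(z : grid k m)
   expR (th * u * k%:R) * x ^+ grid_weight z)).
  rewrite big_mkcond /=; apply: ler_sum => z _.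
  case: ifP => [|_]; last by rewrite mulr_ge0 ?exprn_ge0 ?expR_ge0.
  rewrite inE => zs; rewrite -expRM_natr -expRD; apply: (le_trans _ (expR_ge1Dx _)).
  by rewrite lerDl mulNr subr_ge0 mulrAC [_ * u]mulrC ler_pM2l.
rewrite -mulr_sumr mulrDl addrC expRD ler_pM2l ?expR_gt0//.
rewrite (eq_bigr (fun z : grid k m => \prod_i x ^+ ((z i).1 + (z i).2)));
  last by move=> z _; rewrite /grid_weight expr_sum.
rewrite -(bigA_distr_bigA (fun (_ : 'I_k) (p : 'I_m.+1 * 'I_m.+1) => x ^+ (p.1 + p.2)%N)) /=.
rewrite prodr_const card_ord expRM_natr; apply: lerXn2r; rewrite ?nnegrE ?expR_ge0//.
  by apply: sumr_ge0 => p _; rewrite exprn_ge0 ?expR_ge0.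
have -> : 2 / u = u^-1 + u^-1 by field; rewrite gt_eqF.
rewrite -(pair_big xpredT xpredT (fun i j : 'I_m.+1 => x ^+ (i + j)%N)).
rewrite (eq_bigr (fun i : 'I_m.+1 => x ^+ i * \sum_(j < m.+1) x ^+ j)).
have S0 : 0 <= \sum_(j < m.+1) x ^+ j.
    by apply: sumr_ge0 => i _; rewrite exprn_ge0 ?expR_ge0.
  by rewrite -mulr_suml expRD; apply: ler_pM; rewrite ?S0 ?geo.
by move=> i _; rewrite mulr_sumr; apply: eq_bigr => j _; rewrite exprD.
Qed.

(** Since [Num.trunc] is [0] on negative numbers, at most one of the two terms is nonzero and their
    difference rounds [x] towards zero. *)
Lemma truncn_diff {R : realType} (x : R) :
  [/\ (Num.trunc x + Num.trunc (- x))%:R <= `|x|,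
      `|x - ((Num.trunc x)%:R - (Num.trunc (- x))%:R)| <= 1 &
      `|(Num.trunc x)%:R - (Num.trunc (- x))%:R| <= `|x|].
Proof.
wlog x0 : x / 0 <= x.
  move=> H; have [/H//|/ltW x0] := lerP 0 x.
  have := H (- x); rewrite opprK normrN oppr_ge0 addnC => /(_ x0)[h1 h2 h3].
  split=> //; last by rewrite distrC.
  by move: h2; rewrite -normrN; congr (`|_| <= 1); ring.
have -> : Num.trunc (- x) = 0%N.
  by apply/eqP; rewrite -leqn0 truncn_le_nat; lra.
have /andP[h1 h2] := truncn_itv x0.
rewrite addn0 subr0 normr_nat ger0_norm// ger0_norm ?subr_ge0//; split=> //.
by move: h2; rewrite -natr1; lra.
Qed.

(** The vector [a / s] is rounded towards zero coordinatewise; the weight of the result is at most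
    [l1norm a / s]. *)
Lemma grid_approx {R : realType} {k : nat} (a : 'rV[R]_k) (s th : R) :
  0 < s -> l1norm a <= s * (th * k%:R) ->
  exists2 z : grid k (Num.trunc (th * k%:R)), sparse th z &
    forall i, `|(a - grid_vec s z) ord0 i| <= s /\
              `|grid_vec s z ord0 i| <= `|a ord0 i|.
Proof.
move=> s0 al; set m := Num.trunc _.
pose p i := Num.trunc (a ord0 i / s); pose q i := Num.trunc (- (a ord0 i / s)).
have sum_le : (\sum_i (p i + q i))%:R <= th * k%:R.
  rewrite natr_sum; apply: (@le_trans _ _ (l1norm a / s)).
    rewrite /l1norm mulr_suml; apply: ler_sum => i _.
    have [+ _ _] := truncn_diff (a ord0 i / s).
    by rewrite normrM [`|s^-1|]gtr0_norm ?invr_gt0.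
  by rewrite ler_pdivrMr// mulrC.
(* Each entry is bounded by the total weight, so the entries fit in ['I_m.+1] and [inord] does not
   alter them. *)
have le_m i : (p i + q i <= m)%N.
  rewrite truncn_ge_nat; last exact: le_trans sum_le.
  by apply: le_trans sum_le; rewrite ler_nat (bigD1 i) //= leq_addr.
have pm i : (inord (p i) : 'I_m.+1) = p i :> nat.
  by apply: inordK; rewrite ltnS; apply: leq_trans (le_m i); exact: leq_addr.
have qm i : (inord (q i) : 'I_m.+1) = q i :> nat.
  by apply: inordK; rewrite ltnS; apply: leq_trans (le_m i); exact: leq_addl.
exists [ffun i => (inord (p i), inord (q i))].
  rewrite /sparse /= /grid_weight (eq_bigr (fun i => p i + q i)%N) // => i _.
  by rewrite ffunE /= pm qm.
move=> i; rewrite !mxE !ffunE /= pm qm.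
have [_ h1 h2] := truncn_diff (a ord0 i / s).
have E : a ord0 i = s * (a ord0 i / s) by field; rewrite gt_eqF.
have nE y : `|s * y| = s * `|y| by rewrite normrM gtr0_norm.
rewrite [in X in X /\ _]E -mulrBr nE; split; first by rewrite ger_pMr.
by rewrite nE [X in _ <= `|X|]E nE ler_pM2l.
Qed.

(** * Inequalities between norms, and bounds on the bilinear form *)

Lemma sqnorm_ge0 {R : realType} {k : nat} (a : 'rV[R]_k) : 0 <= sqnorm a.
Proof. by apply: sumr_ge0 => i _; exact: sqr_ge0. Qed.

Lemma sqnormZ {R : realType} {k : nat} (c : R) (a : 'rV[R]_k) :
  sqnorm (c *: a) = c ^+ 2 * sqnorm a.
Proof.
by rewrite /sqnorm mulr_sumr; apply: eq_bigr => i _; rewrite mxE exprMn.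
Qed.

Lemma sqnorm0 {R : realType} {k : nat} : sqnorm (0 : 'rV[R]_k) = 0.
Proof. by rewrite /sqnorm big1// => i _; rewrite mxE expr0n. Qed.

Lemma le_sqnorm {R : realType} {k : nat} (a b : 'rV[R]_k) :
  (forall i, `|a ord0 i| <= `|b ord0 i|) -> sqnorm a <= sqnorm b.
Proof.
move=> ab; apply: ler_sum => i _; rewrite -[leLHS]real_normK ?num_real//.
by rewrite -[leRHS]real_normK ?num_real// lerXn2r ?nnegrE.
Qed.

Lemma sqnorm_le_cst {R : realType} {k : nat} (s : R) (a : 'rV[R]_k) :
  (forall i, `|a ord0 i| <= s) -> sqnorm a <= s ^+ 2 * k%:R.
Proof.
move=> as_; apply: (@le_trans _ _ (\sum_(i < k) s ^+ 2)).
  apply: ler_sum => i _; rewrite -[leLHS]real_normK ?num_real//.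
  by rewrite lerXn2r ?nnegrE// (le_trans _ (as_ i)).
by rewrite sumr_const card_ord mulr_natr.
Qed.

(** Cauchy-Schwarz against the constant vector, obtained by expanding the sum of the squares of
    [n * |a i| - S]. *)
Lemma l1norm_sqr_le {R : realType} {k : nat} (a : 'rV[R]_k) :
  l1norm a ^+ 2 <= k%:R * sqnorm a.
Proof.
have [k0|k0] := posnP k.
  rewrite /l1norm big1 ?expr0n ?mulr_ge0 ?sqnorm_ge0// => i _.
  by have := ltn_ord i; rewrite [in X in (_ < X)%N]k0.
set S := l1norm a; set n : R := k%:R.
have n0 : 0 < n by rewrite ltr0n.
have E : \sum_i (n * `|a ord0 i| - S) ^+ 2 = n * (n * sqnorm a - S ^+ 2).
  rewrite (eq_bigr (fun i => n ^+ 2 * a ord0 i ^+ 2 + (- (2 * n * S)) * `|a ord0 i|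
    + S ^+ 2)); last first.
    by move=> i _; rewrite -[in RHS](real_normK (num_real (a ord0 i))); ring.
  rewrite !big_split /= -!mulr_sumr sumr_const card_ord -[_ *+ k]mulr_natr.
  by rewrite -/(sqnorm a) -/(l1norm a) -/S -/n; ring.
rewrite -subr_ge0 -(pmulr_rge0 _ n0) -E.
by apply: sumr_ge0 => i _; exact: sqr_ge0.
Qed.

Lemma l1norm_le {R : realType} {k : nat} (a : 'rV[R]_k) (r : R) :
  0 <= r -> sqnorm a <= r ^+ 2 -> l1norm a <= r * Num.sqrt k%:R.
Proof.
move=> r0 ar; rewrite -(@ler_pXn2r _ 2) ?nnegrE ?mulr_ge0 ?sqrtr_ge0 ?sumr_ge0//.
rewrite exprMn sqr_sqrtr// mulrC; apply: (le_trans (l1norm_sqr_le a)).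
by rewrite ler_wpM2l.
Qed.

Lemma bilinE {R : realType} {k : nat} (B : 'M[R]_k) (x y : 'rV[R]_k) :
  bilin B x y = \sum_j \sum_i B i j * (x ord0 i * y ord0 j).
Proof.
rewrite /bilin; apply: eq_bigr => j _; rewrite mxE mulr_suml.
by apply: eq_bigr => i _; ring.
Qed.

Lemma bilin_tr {R : realType} {k : nat} (B : 'M[R]_k) (x y : 'rV[R]_k) :
  bilin B^T x y = bilin B y x.
Proof.
rewrite !bilinE exchange_big /=; apply: eq_bigr => j _; apply: eq_bigr => i _.
by rewrite mxE; ring.
Qed.

Lemma bilinDl {R : realType} {k : nat} (B : 'M[R]_k) (x x' y : 'rV[R]_k) :
  bilin B (x + x') y = bilin B x y + bilin B x' y.
Proof.
by rewrite /bilin -big_split /=; apply: eq_bigr => j _; rewrite mulmxDl mxE mulrDl.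
Qed.

Lemma bilinZl {R : realType} {k : nat} (B : 'M[R]_k) (c : R) (x y : 'rV[R]_k) :
  bilin B (c *: x) y = c * bilin B x y.
Proof.
rewrite /bilin mulr_sumr; apply: eq_bigr => j _.
by rewrite -scalemxAl mxE mulrA.
Qed.

Lemma bilinDr {R : realType} {k : nat} (B : 'M[R]_k) (x y y' : 'rV[R]_k) :
  bilin B x (y + y') = bilin B x y + bilin B x y'.
Proof. by rewrite -!(bilin_tr B) bilinDl. Qed.

Lemma bilinZr {R : realType} {k : nat} (B : 'M[R]_k) (c : R) (x y : 'rV[R]_k) :
  bilin B x (c *: y) = c * bilin B x y.
Proof. by rewrite -!(bilin_tr B) bilinZl. Qed.

(** The Euclidean operator norm is at most [M]. A one-sided bound suffices, as [x] may be replaced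
    by [- x]; this form is also symmetric under transposition. *)
Definition bilin_le {R : realType} {k : nat} (B : 'M[R]_k) (M : R) : Prop :=
  forall x y : 'rV[R]_k, sqnorm x <= 1 -> sqnorm y <= 1 -> bilin B x y <= M.

Lemma bilin_le_ge0 {R : realType} {k : nat} (B : 'M[R]_k) (M : R) :
  bilin_le B M -> 0 <= M.
Proof.
move=> /(_ 0 0); rewrite sqnorm0 ler01 -{1}(scale0r (0 : 'rV[R]_k)) bilinZl mul0r.
exact.
Qed.

Lemma bilin_le_tr {R : realType} {k : nat} (B : 'M[R]_k) (M : R) :
  bilin_le B M -> bilin_le B^T M.
Proof. by move=> BM x y x1 y1; rewrite bilin_tr BM. Qed.

Lemma sqnorm_coord {R : realType} {k : nat} (x : 'rV[R]_k) i :
  sqnorm x <= 1 -> `|x ord0 i| <= 1.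
Proof.
move=> x1; rewrite -(@ler_pXn2r _ 2) ?nnegrE// expr1n real_normK ?num_real//.
apply: le_trans x1; rewrite /sqnorm (bigD1 i) //= lerDl.
by apply: sumr_ge0 => j _; exact: sqr_ge0.
Qed.

(** A crude bound, which makes the supremum in [bilin_le_grid] finite. *)
Lemma bilin_le_sum {R : realType} {k : nat} (B : 'M[R]_k) :
  bilin_le B (\sum_j \sum_i `|B i j|).
Proof.
move=> x y x1 y1; rewrite bilinE; apply: ler_sum => j _; apply: ler_sum => i _.
apply: le_trans (ler_norm _) _; rewrite !normrM ler_piMr//.
by rewrite mulr_ile1// sqnorm_coord.
Qed.

(** Duality: the form is tested on [a / r] and on the normalization of [a *m B]. *)
Lemma sqnorm_mul_le {R : realType} {k : nat} (B : 'M[R]_k) (M r : R)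
    (a : 'rV[R]_k) :
  0 < r -> bilin_le B M -> sqnorm a <= r ^+ 2 ->
  sqnorm (a *m B) <= (r * M) ^+ 2.
Proof.
move=> r0 BM ar; set q := sqnorm (a *m B).
have M0 := bilin_le_ge0 BM.
have q0 : 0 <= q by exact: sqnorm_ge0.
have [->|qn] := eqVneq q 0; first exact: sqr_ge0.
have s0 : 0 < Num.sqrt q by rewrite sqrtr_gt0 lt_def qn.
have : bilin B (r^-1 *: a) ((Num.sqrt q)^-1 *: (a *m B)) <= M.
  apply: BM; rewrite sqnormZ exprVn ler_pdivrMl ?exprn_gt0// mulr1//.
  by rewrite sqr_sqrtr.
have -> : bilin B (r^-1 *: a) ((Num.sqrt q)^-1 *: (a *m B)) = r^-1 * Num.sqrt q.
  rewrite bilinZl bilinZr; congr (_ * _).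
  have -> : bilin B a (a *m B) = q by apply: eq_bigr => j _; rewrite expr2.
  by rewrite -{2}(sqr_sqrtr q0); field; rewrite gt_eqF.
rewrite ler_pdivrMl// => h; rewrite -(sqr_sqrtr q0); apply: lerXn2r => //; rewrite nnegrE ?sqrtr_ge0//.
by rewrite mulr_ge0// ltW.
Qed.

(* If [M] is the supremum of the form over the unit ball, rounding both
   arguments to the grid gives [M <= L + M / 4 + M / 4]. *)
Lemma bilin_le_grid {R : realType} {k : nat} (B : 'M[R]_k) (L : R) :
  (0 < k)%N ->
  let s := (4 * Num.sqrt k%:R)^-1 in
  (forall z z' : grid k (Num.trunc (4 * k%:R : R)), sparse (4 : R) z ->
    sparse (4 : R) z' ->
    sqnorm (grid_vec s z) <= 1 -> sqnorm (grid_vec s z') <= 1 ->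
    bilin B (grid_vec s z) (grid_vec s z') <= L) ->
  bilin_le B (2 * L).
Proof.
move=> k0 s BL; set q := Num.sqrt k%:R in s BL.
have q0 : 0 < q by rewrite sqrtr_gt0 ltr0n.
have s0 : 0 < s by rewrite invr_gt0 mulr_gt0.
have qq : q ^+ 2 = k%:R by rewrite sqr_sqrtr.
have approx (x : 'rV[R]_k) : sqnorm x <= 1 ->
    exists2 z : grid k (Num.trunc (4 * k%:R : R)), sparse (4 : R) z &
      sqnorm (grid_vec s z) <= 1 /\
      sqnorm (4 *: (x - grid_vec s z)) <= 1.
  (* The mesh [s] is such that [s * (4 * k)] is [sqrt k], the largest l1-norm on the unit ball. *)
  move=> x1; have xl : l1norm x <= s * (4 * k%:R).
    have -> : s * (4 * k%:R) = 1 * q.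
      by rewrite /s -qq; field; rewrite gt_eqF.
    by apply: l1norm_le => //; rewrite expr1n.
  have [z zs zP] := grid_approx s0 xl; exists z => //; split.
    by apply: le_trans x1; apply: le_sqnorm => i; case: (zP i).
  rewrite sqnormZ; have : sqnorm (x - grid_vec s z) <= s ^+ 2 * k%:R.
    by apply: sqnorm_le_cst => i; case: (zP i).
  (* The rounding error has norm at most [1 / 4], so multiplying it by [4] stays in the unit
     ball. *)
  have -> : s ^+ 2 * k%:R = 16^-1 by rewrite /s -qq; field; rewrite gt_eqF.
  lra.
pose S : set R := [set t | exists x y : 'rV[R]_k,
  [/\ sqnorm x <= 1, sqnorm y <= 1 & t = bilin B x y]]%classic.
have sq0 : sqnorm (0 : 'rV[R]_k) <= 1.
  by rewrite sqnorm0.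
have S0 : (S !=set0)%classic by exists (bilin B 0 0), 0, 0.
have SB : has_ubound S.
  by exists (\sum_j \sum_i `|B i j|) => _ [x [y [x1 y1 ->]]]; exact: bilin_le_sum.
have SP x y : sqnorm x <= 1 -> sqnorm y <= 1 -> bilin B x y <= sup S.
  by move=> x1 y1; apply: ub_le_sup => //; exists x, y.
have : sup S <= L + sup S / 4 + sup S / 4.
  apply: ge_sup => // _ [x [y [x1 y1 ->]]].
  have [z zs [z1 z4]] := approx x x1; have [w ws [w1 w4]] := approx y y1.
  set v := grid_vec s z in z1 z4 *; set v' := grid_vec s w in w1 w4 *.
  have -> : bilin B x y = bilin B v v' + bilin B (4 *: (x - v)) v' / 4 +
            bilin B x (4 *: (y - v')) / 4.
    have e1 : bilin B x y = bilin B x (y - v') + bilin B x v'.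
      by rewrite -bilinDr subrK.
    have e2 : bilin B x v' = bilin B (x - v) v' + bilin B v v'.
      by rewrite -bilinDl subrK.
    by rewrite bilinZl bilinZr e1 e2; field.
  have := BL z w zs ws z1 w1; have := SP _ _ z4 w1; have := SP _ _ x1 w4.
  rewrite -/v -/v'; lra.
by move=> h x y x1 y1; have := SP x y x1 y1; lra.
Qed.

(** * The deterministic lower bound for the l1-norm *)

Lemma l1norm_ge0 {R : realType} {k : nat} (a : 'rV[R]_k) : 0 <= l1norm a.
Proof. exact: sumr_ge0. Qed.

(* Either [a] has large l1-norm, or it is well approximated by a sparse grid
   vector [v], where [|aB|_1 >= |vB|_1 - sqrt k |(a - v)B|_2]. *)
Lemma l1norm_lower {R : realType} {k : nat} (B : 'M[R]_k) (a : 'rV[R]_k)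
    (c h th M : R) :
  (0 < k)%N -> 0 < h -> h <= 2^-1 -> 0 < th -> 2 * (h * M) <= c ->
  bilin_le B (M * Num.sqrt k%:R) -> sqnorm a = 1 ->
  (forall z : grid k (Num.trunc (th * k%:R)), sparse th z ->
    4^-1 <= sqnorm (grid_vec (h / Num.sqrt k%:R) z) <= 1 ->
    c * k%:R <= l1norm (grid_vec (h / Num.sqrt k%:R) z *m B)) ->
  Num.min (h * th) (c / 2) * k%:R <= Num.sqrt k%:R * l1norm a + l1norm (a *m B).
Proof.
move=> k0 h0 h2 th0 hM BM a1 Bz; set q := Num.sqrt k%:R in BM Bz *.
have q0 : 0 < q by rewrite sqrtr_gt0 ltr0n.
have qq : q ^+ 2 = k%:R by rewrite sqr_sqrtr.
have kR : 0 < k%:R :> R by rewrite ltr0n.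
set D := Num.min _ _.
have D1 : D * k%:R <= (h * th) * k%:R by rewrite ler_pM2r// ge_min lexx.
have D2 : D * k%:R <= (c / 2) * k%:R by rewrite ler_pM2r// ge_min lexx orbT.
have [al|al] := leP (l1norm a) (h / q * (th * k%:R)); last first.
  have := l1norm_ge0 (a *m B).
  suff : h * th * k%:R <= q * l1norm a by lra.
  have -> : h * th * k%:R = q * (h / q * (th * k%:R)) by field; rewrite gt_eqF.
  by rewrite ler_pM2l// ltW.
have [z zs zP] := grid_approx (divr_gt0 h0 q0) al.
set v := grid_vec _ z in zP.
have va : sqnorm (a - v) <= h ^+ 2.
  have -> : h ^+ 2 = (h / q) ^+ 2 * k%:R by rewrite -qq; field; rewrite gt_eqF.
  by apply: sqnorm_le_cst => i; case: (zP i).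
have v1 : sqnorm v <= 1.
  by rewrite -a1; apply: le_sqnorm => i; case: (zP i).
(* Rounding does not shrink [a] too much: [1 = sqnorm a <= 2 * sqnorm v + 2 * h ^+ 2] with
   [h <= 1 / 2]. *)
have v4 : 4^-1 <= sqnorm v.
  have : sqnorm a <= 2 * sqnorm v + 2 * sqnorm (a - v).
    rewrite /sqnorm !mulr_sumr -big_split /=; apply: ler_sum => i _.
    by rewrite !mxE; have := sqr_ge0 (a ord0 i - 2 * v ord0 i); rewrite mxE; lra.
  have : h ^+ 2 <= 4^-1.
    have -> : 4^-1 = 2^-1 ^+ 2 :> R by field.
    by rewrite lerXn2r ?nnegrE ?(ltW h0)//; lra.
  by rewrite a1; lra.
have /Bz : sparse th z by [].
rewrite -/v v4 v1 => /(_ isT) hv.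
have l1D : l1norm (v *m B) <= l1norm (a *m B) + l1norm ((a - v) *m B).
  rewrite /l1norm -big_split /=; apply: ler_sum => j _.
  by rewrite mulmxBl !mxE -normrN -[leLHS]/(`|_|);
    apply: le_trans (ler_normB _ _); rewrite opprB addrC subrK normrN.
have M0 := bilin_le_ge0 BM.
have : l1norm ((a - v) *m B) <= h * (M * q) * q.
  apply: l1norm_le; first by rewrite mulr_ge0// ltW.
  exact: sqnorm_mul_le.
have -> : h * (M * q) * q = h * M * k%:R by rewrite -qq; ring.
(* The rounding error costs at most half of the lower bound [c * k] for [v]. *)
have : 2 * (h * M) * k%:R <= c * k%:R by rewrite ler_pM2r.
have : 0 <= q * l1norm a by rewrite mulr_ge0 ?l1norm_ge0// ltW.
lra.
Qed.

(** * Probability bounds for random sign matrices *)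

Lemma mul_sign_mxE {R : realType} {k : nat} (x : 'rV[R]_k) (e : 'M[bool]_k) j :
  (x *m sign_mx R e) ord0 j = rad_sum (fun i => x ord0 i) (col_ffun e j).
Proof.
rewrite mxE; apply: eq_bigr => i _.
by rewrite mxE ffunE mulrC.
Qed.

Lemma card_signs_gt0 (k : nat) : (0 < #|{: 'M[bool]_k}|)%N.
Proof. by rewrite card_mx expn_gt0 card_bool. Qed.

(** Chernoff's bound with parameter [sqrt k]: the threshold gives the exponent [- 15 * k], and the
    exponential moment adds at most [2 * k]. *)
Lemma pr_bilin_gt {R : realType} {k : nat} (x y : 'rV[R]_k) :
  sqnorm x <= 1 -> sqnorm y <= 1 ->
  uniform_pr R (fun e => 15 * Num.sqrt k%:R < bilin (sign_mx R e) x y) <=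
  expR (- (13 * k%:R)).
Proof.
move=> x1 y1; set q := Num.sqrt k%:R.
have qq : q ^+ 2 = k%:R by rewrite sqr_sqrtr.
have q0 : 0 <= q by exact: sqrtr_ge0.
pose w j i := q * (x ord0 i * y ord0 j).
pose F (e : 'M[bool]_k) := expR (- (15 * k%:R)) *
  \prod_j expR (rad_sum (w j) (col_ffun e j)).
have FE e : F e = expR (q * (bilin (sign_mx R e) x y - 15 * q)).
  rewrite /F -expR_sum -expRD; congr expR.
  rewrite mulrBr /bilin mulr_sumr addrC; congr (_ + _).
    apply: eq_bigr => j _; rewrite mul_sign_mxE /rad_sum mulr_suml mulr_sumr.
    by apply: eq_bigr => i _; rewrite /w; ring.
  by rewrite -qq; ring.
apply: (@le_trans _ _ (mean F)).
  apply: uniform_pr_le_mean => e; rewrite FE ?expR_ge0// => He.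
  apply: le_trans (expR_ge1Dx _).
  by rewrite lerDl mulr_ge0// subr_ge0 ltW.
rewrite meanZ (mean_prod_col (fun j f => expR (rad_sum (w j) f))).
have -> : - (13 * k%:R) = - (15 * k%:R) + 2 * k%:R :> R by ring.
rewrite expRD ler_pM2l ?expR_gt0//.
apply: (@le_trans _ _ (\prod_j expR (2 * \sum_i w j i ^+ 2))).
  apply: ler_prod => j _; rewrite mean_rad_exp andbT.
  by rewrite /mean divr_ge0// sumr_ge0// => f _; exact: expR_ge0.
rewrite -expR_sum ler_expR -mulr_sumr ler_pM2l//.
have -> : \sum_j \sum_i w j i ^+ 2 = k%:R * (sqnorm x * sqnorm y).
  rewrite [sqnorm y]/sqnorm !mulr_sumr; apply: eq_bigr => j _.
  rewrite /sqnorm mulr_suml mulr_sumr; apply: eq_bigr => i _.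
  by rewrite /w !exprMn qq; ring.
by rewrite ler_piMr// mulr_ile1// sqnorm_ge0.
Qed.

Lemma pr_bilin_le {R : realType} {k : nat} : (0 < k)%N ->
  uniform_pr R (fun e : 'M[bool]_k =>
    ~ bilin_le (sign_mx R e) (30 * Num.sqrt k%:R)) <= expR (- k%:R).
Proof.
move=> k0; set q := Num.sqrt k%:R; set s := (4 * q)^-1.
pose G := grid k (Num.trunc (4 * k%:R : R)).
pose P : pred (G * G) := [pred z | [&& sparse (4 : R) z.1, sparse (4 : R) z.2,
  sqnorm (grid_vec s z.1) <= 1 & sqnorm (grid_vec s z.2) <= 1]].
pose E (z : G * G) (e : 'M[bool]_k) :=
  15 * q < bilin (sign_mx R e) (grid_vec s z.1) (grid_vec s z.2).
apply: (@le_trans _ _ (uniform_pr R (fun e => exists2 z, P z & E z e))).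
  apply: le_uniform_pr => e; apply: contra_notP => nE.
  have -> : 30 * q = 2 * (15 * q) by ring.
  apply: bilin_le_grid => // z z' zs zs' z1 z1'; rewrite leNgt.
  apply/negP => lt; apply: nE; exists (z, z') => //.
  by rewrite /P /= zs zs' z1 z1'.
apply: le_trans (uniform_pr_bigU _) _.
  by move=> z /and4P[_ _ z1 z1']; exact: pr_bilin_gt.
have cP : (#|P| <= #|@sparse R k (Num.trunc (4 * k%:R : R)) 4| ^ 2)%N.
  rewrite expnS expn1 -cardX; apply: subset_leq_card; apply/fintype.subsetP => z.
  by move=> /and4P[zs zs' _ _]; apply/andP; split.
(* With [u = 1] and [th = 4], [card_sparse] allows [expR (6 * k)] choices for each of the two
   vectors; the rate [13] beats [12]. *)
have c6 : #|P|%:R <= expR (12 * k%:R) :> R.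
  apply: (@le_trans _ _ (expR ((2 / 1 + 4 * 1) * k%:R) ^+ 2)).
    rewrite (le_trans (y := (#|@sparse R k (Num.trunc (4 * k%:R : R)) 4| ^ 2)%:R))
      ?ler_nat// natrX.
    by apply: lerXn2r; rewrite ?nnegrE ?expR_ge0//; exact: card_sparse.
  by rewrite -expRM_natr ler_expR; lra.
have -> : - k%:R = 12 * k%:R - 13 * k%:R :> R by ring.
by rewrite expRD ler_wpM2r ?expR_ge0.
Qed.

(** Chernoff's bound with parameter [l]: each of the [k] independent columns contributes a factor at
    most [expR (- l ^+ 2)], and the threshold [l / 2 * k] gives back half of the exponent. *)
Lemma pr_l1norm_lt {R : realType} {k : nat} (l : R) (b : 'rV[R]_k) :
  0 < l ->
  (forall (I : finType) (w : I -> R), 4^-1 <= \sum_i w i ^+ 2 <= 1 ->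
    mean (fun f => expR (- (l * `|rad_sum w f|))) <= expR (- l ^+ 2)) ->
  4^-1 <= sqnorm b <= 1 ->
  uniform_pr R (fun e => l1norm (b *m sign_mx R e) < l / 2 * k%:R) <=
  expR (- (l ^+ 2 / 2 * k%:R)).
Proof.
move=> l0 lP b41.
pose w i := b ord0 i.
pose F (e : 'M[bool]_k) := expR (l ^+ 2 / 2 * k%:R) *
  \prod_j expR (- (l * `|rad_sum w (col_ffun e j)|)).
have FE e : F e = expR (l * (l / 2 * k%:R - l1norm (b *m sign_mx R e))).
  rewrite /F -expR_sum -expRD; congr expR.
  rewrite mulrBr; congr (_ + _); first by ring.
  rewrite sumrN /l1norm mulr_sumr; congr (- _).
  by apply: eq_bigr => j _; rewrite mul_sign_mxE.
apply: (@le_trans _ _ (mean F)).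
  apply: uniform_pr_le_mean => e; rewrite FE ?expR_ge0// => He.
  apply: le_trans (expR_ge1Dx _).
  by rewrite lerDl mulr_ge0 ?(ltW l0)// subr_ge0 ltW.
rewrite meanZ (mean_prod_col (fun j f => expR (- (l * `|rad_sum w f|)))).
have -> : - (l ^+ 2 / 2 * k%:R) = l ^+ 2 / 2 * k%:R + - l ^+ 2 * k%:R by field.
rewrite expRD ler_pM2l ?expR_gt0// prodr_const card_ord expRM_natr.
apply: lerXn2r; rewrite ?nnegrE ?expR_ge0//; last exact: lP.
by rewrite /mean divr_ge0// sumr_ge0// => f _; exact: expR_ge0.
Qed.

(** Union bound over sparse vectors. Sparsity [u ^- 2] makes the counting exponent
    [2 / u + u ^- 2 * u = 3 / u], which is small for large [u]. *)
Lemma pr_sparse_l1norm {R : realType} {k : nat} (l u s : R) : 0 < l -> 0 < u ->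
  (forall (I : finType) (w : I -> R), 4^-1 <= \sum_i w i ^+ 2 <= 1 ->
    mean (fun f => expR (- (l * `|rad_sum w f|))) <= expR (- l ^+ 2)) ->
  uniform_pr R (fun e : 'M[bool]_k =>
    ~ forall z : grid k (Num.trunc (u ^- 2 * k%:R)), sparse (u ^- 2) z ->
      4^-1 <= sqnorm (grid_vec s z) <= 1 ->
      l / 2 * k%:R <= l1norm (grid_vec s z *m sign_mx R e)) <=
  expR ((3 / u - l ^+ 2 / 2) * k%:R).
Proof.
move=> l0 u0 lP; pose G := grid k (Num.trunc (u ^- 2 * k%:R)).
pose P : pred G := [pred z | sparse (u ^- 2) z && (4^-1 <= sqnorm (grid_vec s z) <= 1)].
pose E (z : G) (e : 'M[bool]_k) :=
  l1norm (grid_vec s z *m sign_mx R e) < l / 2 * k%:R.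
apply: (@le_trans _ _ (uniform_pr R (fun e => exists2 z, P z & E z e))).
  apply: le_uniform_pr => e; apply: contra_notP => nE z zs z41; rewrite leNgt.
  by apply/negP => lt; apply: nE; exists z => //; rewrite /P /= zs.
apply: le_trans (uniform_pr_bigU _) _.
  by move=> z /andP[_ z41]; exact: pr_l1norm_lt.
rewrite mulrBl expRD; apply: ler_wpM2r; first exact: expR_ge0.
apply: (@le_trans _ _ #|@sparse R k (Num.trunc (u ^- 2 * k%:R)) (u ^- 2)|%:R).
  by rewrite ler_nat; apply: subset_leq_card; apply/fintype.subsetP => z /andP[].
have -> : 3 / u = 2 / u + u ^- 2 * u by field; rewrite gt_eqF.
exact: card_sparse.
Qed.

Lemma sign_mx_tr {R : realType} {k : nat} (e : 'M[bool]_k) :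
  sign_mx R e^T = (sign_mx R e)^T.
Proof. by apply/matrixP => i j; rewrite !mxE. Qed.

(** Transposition is an involution, so bounds for [B] also hold for its transpose, which occurs in
    [mxAbar]. *)
Lemma uniform_pr_tr {R : realType} {k : nat} (E : 'M[bool]_k -> Prop) :
  uniform_pr R (fun e => E e^T) = uniform_pr R E.
Proof.
rewrite !uniform_prE.
exact: (mean_reindex (fun e => (`[< E e >])%:R) (@trmxK _ _ _)).
Qed.

(** * Normalized norms and a deterministic criterion for good signs *)

Lemma Lpn_norm1E {R : realType} {n : nat} (x : 'rV[R]_n) :
  Lpn_norm 1 x = n%:R^-1 * l1norm x.
Proof.
rewrite /Lpn_norm invr1 powRr1; last first.
  by rewrite mulr_ge0 ?invr_ge0// sumr_ge0// => i _; exact: powR_ge0.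
by congr (_ * _); apply: eq_bigr => i _; rewrite powRr1.
Qed.

Lemma Lpn_norm2E {R : realType} {n : nat} (x : 'rV[R]_n) :
  Lpn_norm 2 x = Num.sqrt (n%:R^-1 * sqnorm x).
Proof.
rewrite /Lpn_norm powR12_sqrt; last first.
  by rewrite mulr_ge0 ?invr_ge0// sumr_ge0// => i _; exact: powR_ge0.
congr (Num.sqrt (_ * _)); apply: eq_bigr => i _.
by rewrite powR_mulrn// real_normK ?num_real.
Qed.

(** The divisions by [2] come from normalizing by [k + k] instead of [k]; the middle inequality is
    [l1norm_sqr_le]. *)
Lemma norms_within_row_mx {R : realType} {k : nat} (C D E : R)
    (p q : 'rV[R]_k) :
  (0 < k)%N -> 0 < C -> C^-1 <= D / 2 -> (1 + E) / 2 <= C ^+ 2 ->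
  D * k%:R <= l1norm p + l1norm q -> sqnorm p + sqnorm q <= (1 + E) * k%:R ->
  norms_within C (row_mx p q).
Proof.
move=> k0 C0 CD CE Dk Ek; have kR : 0 < k%:R :> R by rewrite ltr0n.
have l1E : l1norm (row_mx p q) = l1norm p + l1norm q.
  rewrite /l1norm big_split_ord /=; congr (_ + _); apply: eq_bigr => i _.
    by rewrite row_mxEl.
  by rewrite row_mxEr.
have sqE : sqnorm (row_mx p q) = sqnorm p + sqnorm q.
  rewrite /sqnorm big_split_ord /=; congr (_ + _); apply: eq_bigr => i _.
    by rewrite row_mxEl.
  by rewrite row_mxEr.
have kk : (k + k)%:R = 2 * k%:R :> R by rewrite natrD; ring.
have kk0 : 0 < (k + k)%:R :> R by rewrite kk mulr_gt0.
rewrite /norms_within Lpn_norm1E Lpn_norm2E; split.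
- apply: (le_trans CD); rewrite l1E ler_pdivlMl// kk; lra.
- rewrite -(@ler_pXn2r _ 2) ?nnegrE ?sqrtr_ge0//; last first.
    by rewrite mulr_ge0 ?invr_ge0 ?l1norm_ge0// ltW.
  rewrite sqr_sqrtr; last by rewrite mulr_ge0 ?invr_ge0 ?sqnorm_ge0// ltW.
  rewrite exprMn expr2 -mulrA ler_pM2l ?invr_gt0// ler_pdivrMl//.
  exact: l1norm_sqr_le.
- rewrite -(@ler_pXn2r _ 2) ?nnegrE ?sqrtr_ge0 ?(ltW C0)//.
  rewrite sqr_sqrtr; last by rewrite mulr_ge0 ?invr_ge0 ?sqnorm_ge0// ltW.
  by apply: le_trans CE; rewrite sqE ler_pdivrMl// kk; lra.
Qed.

Lemma l1normZ {R : realType} {k : nat} (c : R) (a : 'rV[R]_k) :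
  0 <= c -> l1norm (c *: a) = c * l1norm a.
Proof.
move=> c0; rewrite /l1norm mulr_sumr; apply: eq_bigr => i _.
by rewrite mxE normrM ger0_norm.
Qed.

Lemma l1normN {R : realType} {k : nat} (a : 'rV[R]_k) : l1norm (- a) = l1norm a.
Proof. by apply: eq_bigr => i _; rewrite mxE normrN. Qed.

Lemma sqnormN {R : realType} {k : nat} (a : 'rV[R]_k) : sqnorm (- a) = sqnorm a.
Proof. by apply: eq_bigr => i _; rewrite mxE sqrrN. Qed.

(** Unnormalized bounds for [a *m mxA B]: the block [sqrt k I] gives the term [sqrt k * l1norm a],
    and adds exactly [k] to the squared norm. The same property of the transpose handles
    [mxAbar]. *)
Definition well_spread {R : realType} {k : nat} (D E : R) (B : 'M[R]_k) : Prop :=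
  forall a : 'rV[R]_k, sqnorm a = 1 ->
    D * k%:R <= Num.sqrt k%:R * l1norm a + l1norm (a *m B) /\
    sqnorm (a *m B) <= E * k%:R.

Lemma good_signs_well_spread {R : realType} {k : nat} (C D E : R)
    (e : 'M[bool]_k) :
  (0 < k)%N -> 0 < C -> C^-1 <= D / 2 -> (1 + E) / 2 <= C ^+ 2 ->
  well_spread D E (sign_mx R e) -> well_spread D E (sign_mx R e)^T ->
  good_signs C e.
Proof.
move=> k0 C0 CD CE BS BTS a aS.
have a1 : sqnorm a = 1.
  by rewrite -[LHS]sqr_sqrtr ?sqnorm_ge0// [Num.sqrt _]aS expr1n.
pose q : R := Num.sqrt k%:R.
have qa : sqnorm (q *: a) = k%:R by rewrite sqnormZ a1 mulr1 sqr_sqrtr.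
have la : l1norm (q *: a) = q * l1norm a by rewrite l1normZ ?sqrtr_ge0.
have [h1 h2] := BS a a1; have [h3 h4] := BTS a a1.
rewrite -/q in h1 h3.
split; rewrite mul_mx_row -scalemxAr mulmx1 ?mulmxN -/q.
  by apply: (norms_within_row_mx (D := D) (E := E)) => //; rewrite ?qa ?la//; lra.
apply: (norms_within_row_mx (D := D) (E := E)) => //;
  rewrite ?qa ?la ?l1normN ?sqnormN//; lra.
Qed.

Lemma well_spread_le {R : realType} {k : nat} (D D' E E' : R) (B : 'M[R]_k) :
  D' <= D -> E <= E' -> well_spread D E B -> well_spread D' E' B.
Proof.
move=> DD EE BS a a1; have [h1 h2] := BS a a1; split.
  by apply: le_trans h1; rewrite ler_wpM2r.
by apply: (le_trans h2); rewrite ler_wpM2r.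
Qed.

(** For a unit vector, [l1norm a >= sqnorm a = 1], and every entry of [a *m B] is at most
    [l1norm a <= sqrt k]. *)
Lemma well_spread_small {R : realType} {k : nat} (K : R) (B : 'M[R]_k) :
  (0 < k)%N -> 0 < K -> k%:R <= K -> (forall i j, `|B i j| <= 1) ->
  well_spread K^-1 K B.
Proof.
move=> k0 K0 kK B1 a a1; set q := Num.sqrt k%:R.
have la : l1norm a <= q.
  by rewrite -[leRHS]mul1r; apply: l1norm_le => //; rewrite a1 expr1n.
split.
  have q1 : 1 <= q by rewrite -sqrtr1 ler_sqrt// ler1n.
  have l1 : 1 <= l1norm a.
    rewrite -a1; apply: ler_sum => i _.
    have ai : `|a ord0 i| <= 1 by apply: sqnorm_coord; rewrite a1.
    by rewrite -(real_normK (num_real (a ord0 i))) expr2 ler_piMr.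
  have : K^-1 * k%:R <= 1 by rewrite ler_pdivrMl// mulr1.
  have := l1norm_ge0 (a *m B).
  have : 1 <= q * l1norm a by rewrite -[leLHS]mulr1 ler_pM.
  lra.
apply: (@le_trans _ _ (q ^+ 2 * k%:R)).
  apply: sqnorm_le_cst => j; apply: le_trans la; rewrite mxE.
  apply: le_trans (ler_norm_sum _ _ _) _; apply: ler_sum => i _.
  by rewrite normrM ler_piMr.
by rewrite ler_wpM2r// sqr_sqrtr.
Qed.

(** * Choice of the constants and conclusion *)

Lemma pr_not_well_spread {R : realType} : exists eta D E : R,
  [/\ 0 < eta, 0 < D, 0 < E & forall k : nat, (0 < k)%N ->
  uniform_pr R (fun e : 'M[bool]_k => ~ (well_spread D E (sign_mx R e) /\
    well_spread D E (sign_mx R e)^T)) <= 3 * expR (- (2 * eta * k%:R))].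
Proof.
have [l [/andP[l0 l1] lP]] := mean_rad_exp_abs R.
(* This makes [3 / u = l ^+ 2 / 4], half of the Chernoff rate [l ^+ 2 / 2]; what remains is
   [2 * eta] with [eta = l ^+ 2 / 8]. *)
set u := 12 / l ^+ 2.
have u0 : 0 < u by rewrite divr_gt0// exprn_gt0.
(* With [M = 30] and [c = l / 2], the condition [2 * (h * M) <= c] of [l1norm_lower] is an
   equality. *)
set h := l / 120; set th := u ^- 2.
have h0 : 0 < h by rewrite divr_gt0.
have th0 : 0 < th by rewrite invr_gt0 exprn_gt0.
exists (l ^+ 2 / 8), (Num.min (h * th) (l / 2 / 2)), (30 ^+ 2); split=> //.
- by rewrite divr_gt0// exprn_gt0.
- by rewrite lt_min mulr_gt0//=; lra.
move=> k k0; set D := Num.min _ _; pose q : R := Num.sqrt k%:R.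
pose E1 (e : 'M[bool]_k) := ~ bilin_le (sign_mx R e) (30 * q).
pose E2 (e : 'M[bool]_k) :=
  ~ forall z : grid k (Num.trunc (th * k%:R)), sparse th z ->
      4^-1 <= sqnorm (grid_vec (h / q) z) <= 1 ->
      l / 2 * k%:R <= l1norm (grid_vec (h / q) z *m sign_mx R e).
have p1 : uniform_pr R E1 <= expR (- (2 * (l ^+ 2 / 8) * k%:R)).
  apply: le_trans (pr_bilin_le k0) _; rewrite ler_expR lerN2 ler_piMl//.
  have : l ^+ 2 <= 1 by rewrite expr_le1// ltW.
  lra.
have p2 : uniform_pr R E2 <= expR (- (2 * (l ^+ 2 / 8) * k%:R)).
  apply: le_trans (pr_sparse_l1norm _ l0 u0 lP) _; rewrite ler_expR.
  have -> : 3 / u = l ^+ 2 / 4 by rewrite /u; field; rewrite gt_eqF.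
  lra.
(* Three bad events suffice: the operator norm bound passes to the transpose, while the l1 bound is
   needed for both matrices. *)
apply: (@le_trans _ _ (uniform_pr R (fun e => E1 e \/ (E2 e \/ E2 e^T)))).
  have spread B : bilin_le B (30 * q) -> 
      (forall z : grid k (Num.trunc (th * k%:R)), sparse th z ->
      4^-1 <= sqnorm (grid_vec (h / q) z) <= 1 ->
      l / 2 * k%:R <= l1norm (grid_vec (h / q) z *m B)) -> well_spread D (30 ^+ 2) B.
    move=> Bop Bl a a1; split.
      by apply: (l1norm_lower (M := 30)) => //; rewrite /h; lra.
    have -> : 30 ^+ 2 * k%:R = (1 * (30 * q)) ^+ 2.
      by rewrite mul1r exprMn sqr_sqrtr.
    by apply: sqnorm_mul_le => //; rewrite a1 expr1n.
  apply: le_uniform_pr => e; apply: contra_notP => /not_orP[/contrapT e1].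
  move=> /not_orP[/contrapT e2 /contrapT e3]; split; first exact: spread.
  by apply: spread; [exact: bilin_le_tr|rewrite -sign_mx_tr].
have p3 : uniform_pr R (fun e : 'M[bool]_k => E2 e^T) <=
    expR (- (2 * (l ^+ 2 / 8) * k%:R)) by rewrite uniform_pr_tr.
apply: (le_trans (uniform_prU _ _)).
apply: (le_trans (lerD p1 (le_trans (uniform_prU _ _) (lerD p2 p3)))).
lra.
Qed.

Unset Implicit Arguments.
Set Strict Implicit.

Theorem theorem1 (R : realType) :
  exists eta C : R, 0 < eta /\ 0 < C /\
    forall k : nat, (0 < k)%N ->
      (exists e : 'M[bool]_k, good_signs C e) /\
      1 - expR (- (eta * k%:R)) < uniform_pr R (fun e : 'M[bool]_k => good_signs C e).
Proof.
have [eta [D [E [eta0 D0 E0 bad]]]] := @pr_not_well_spread R.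
(* For [k > K], [expR (eta * k) >= 1 + eta * k > 3] absorbs the factor [3] at the price of half of
   the rate [2 * eta]. *)
pose K := 2 / eta; pose D' := Num.min D K^-1.
have K0 : 0 < K by rewrite divr_gt0.
have D'0 : 0 < D' by rewrite lt_min D0 invr_gt0.
(* The first term of [C] gives the lower bounds; the second gives [C >= 1], hence
   [C ^+ 2 >= C >= (1 + E') / 2]. *)
pose E' := E + K; pose C := 2 / D' + (1 + E').
have [DD DK] : D' <= D /\ D' <= K^-1 by rewrite !ge_min !lexx orbT.
have E'0 : 0 < E' by rewrite addr_gt0.
have dD : 0 < 2 / D' by rewrite divr_gt0.
have C0 : 0 < C by rewrite /C; lra.
have CD : C^-1 <= D' / 2.
  rewrite -[leRHS]invrK lef_pV2 ?posrE ?invr_gt0 ?divr_gt0// invf_div /C; lra.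
have CE : (1 + E') / 2 <= C ^+ 2.
  have : 1 * C <= C ^+ 2 by rewrite expr2 ler_wpM2r /C//; lra.
  by rewrite /C; lra.
exists eta, C; split=> //; split=> // k k0.
(* Existence follows: without good signs the probability would be [0], but the left side is
   nonnegative. *)
suff pr : 1 - expR (- (eta * k%:R)) <
    uniform_pr R (fun e : 'M[bool]_k => good_signs C e).
  split=> //; apply: contrapT => /forallNP none; move: pr; apply/negP.
  rewrite -leNgt; apply: (@le_trans _ _ (mean (fun _ : 'M[bool]_k => 0))).
    by apply: uniform_pr_le_mean => // e /none.
  by rewrite mean_cst ?card_signs_gt0// subr_ge0 -expR0 ler_expR oppr_le0
    mulr_ge0// ltW.
rewrite -[ltRHS](subKr 1) -uniform_prC ?card_signs_gt0// ltrD2l ltrN2.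
have kR : 0 < k%:R :> R by rewrite ltr0n.
have [kK|Kk] := leP k%:R K.
  (* For [k <= K] every choice of signs is good, so the failure probability is [0]. *)
  apply: (@le_lt_trans _ _ (mean (fun _ : 'M[bool]_k => 0))); last first.
    by rewrite mean_cst ?card_signs_gt0 ?expR_gt0.
  apply: uniform_pr_le_mean => // e [].
  have small (B : 'M[R]_k) : (forall i j, `|B i j| <= 1) -> well_spread D' E' B.
    move=> B1; apply: (@well_spread_le _ _ K^-1 _ K) => //; first by rewrite lerDr ltW.
    exact: well_spread_small.
  by apply: (good_signs_well_spread k0 C0 CD CE); apply: small => i j;
    rewrite !mxE normrX normrN1 expr1n.
apply: (@le_lt_trans _ _ (3 * expR (- (2 * eta * k%:R)))).
  apply: le_trans (bad k k0); apply: le_uniform_pr => e; apply: contra_not.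
  move=> [s1 s2]; apply: (good_signs_well_spread k0 C0 CD CE);
    by [apply: well_spread_le s1 => //; rewrite lerDl ltW
       |apply: well_spread_le s2 => //; rewrite lerDl ltW].
have -> : - (2 * eta * k%:R) = - (eta * k%:R) + - (eta * k%:R) by ring.
rewrite expRD mulrA -[ltRHS]mul1r ltr_pM2r ?expR_gt0//.
rewrite expRN ltr_pdivrMr ?expR_gt0// mul1r; apply: lt_le_trans (expR_ge1Dx _).
by move: Kk; rewrite /K ltr_pdivrMr//; lra.
Qed.
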